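(* Let $X$ be a separable Banach space. The following are equivalent: (i) $X^\ast$ is non-separable; (ii) for every $\epsilon>0$ there exists a bounded linear operator $T:X\to C(\{0,1\}^\omega)$ with $\|T\|\le 1+\epsilon$ and $\{\chi_{\Delta_t}:t\in\mathcal{D}\}\subseteq T(B_X)$; (iii) for every $\epsilon>0$ there exists a bounded linear operator $R:X\to C(\{0,1\}^\omega)$ with $\|R\|\le 2+\epsilon$ and $\{h_m:m\ge 0\}\subseteq R(B_X)$.
   Context: $B_X$ is the closed unit ball of $X$. $\{0,1\}^\omega$ is the Cantor set with product topology; $\mathcal{D}=\bigcup_{n<\omega}\{0,1\}^n$ is the set of finite sequences in $\{0,1\}$; for $t\in\mathcal{D}$, $\Delta_t$ is the set of $s\in\{0,1\}^\omega$ having $t$ as initial segment, and $t^\frown i$ is $t$ with $i$ appended. The Haar functions are $h_0=\chi_{\{0,1\}^\omega}$ together with the functions $\chi_{\Delta_{t^\frown0}}-\chi_{\Delta_{t^\frown1}}$, $t\in\mathcal{D}$ (indexed as $h_m$, $m\ge1$, via a fixed enumeration of $\mathcal{D}$). *)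

(* Defs.v *)
From Stdlib Require Import Reals List.
Open Scope R_scope.

Record Banach := {
  BV :> Type;
  bzero : BV;
  badd : BV -> BV -> BV;
  bopp : BV -> BV;
  bscal : R -> BV -> BV;
  bnorm : BV -> R;
  badd_assoc : forall x y z, badd x (badd y z) = badd (badd x y) z;
  badd_comm : forall x y, badd x y = badd y x;
  badd_0 : forall x, badd bzero x = x;
  badd_opp : forall x, badd x (bopp x) = bzero;
  bscal_1 : forall x, bscal 1 x = x;
  bscal_assoc : forall a b x, bscal a (bscal b x) = bscal (a * b) x;
  bscal_addl : forall a b x, bscal (a + b) x = badd (bscal a x) (bscal b x);
  bscal_addr : forall a x y, bscal a (badd x y) = badd (bscal a x) (bscal a y);
  bnorm_ge0 : forall x, 0 <= bnorm x;
  bnorm_eq0 : forall x, bnorm x = 0 -> x = bzero;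
  bnorm_scal : forall a x, bnorm (bscal a x) = Rabs a * bnorm x;
  bnorm_triangle : forall x y, bnorm (badd x y) <= bnorm x + bnorm y;
  bcomplete : forall u : nat -> BV,
    (forall eps, 0 < eps -> exists N, forall m n, (N <= m)%nat -> (N <= n)%nat ->
        bnorm (badd (u m) (bopp (u n))) < eps) ->
    exists l, forall eps, 0 < eps -> exists N, forall n, (N <= n)%nat ->
        bnorm (badd (u n) (bopp l)) < eps
}.

Arguments bzero {_}. Arguments badd {_}. Arguments bopp {_}.
Arguments bscal {_}. Arguments bnorm {_}.

Definition separable (X : Banach) : Prop :=
  exists d : nat -> X, forall x eps, 0 < eps ->
    exists n, bnorm (badd x (bopp (d n))) < eps.

Definition is_linear_fun (X : Banach) (f : X -> R) : Prop :=
  (forall x y, f (badd x y) = f x + f y) /\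
  (forall a x, f (bscal a x) = a * f x).

Definition bounded_functional (X : Banach) (f : X -> R) : Prop :=
  is_linear_fun X f /\ exists C, forall x, Rabs (f x) <= C * bnorm x.

(** X^star is separable for the dual (operator) norm: a sequence of elements of
    X^star that is norm-dense; ||f - g|| <= eps means |f x - g x| <= eps ||x||. *)
Definition dual_separable (X : Banach) : Prop :=
  exists d : nat -> (X -> R),
    (forall n, bounded_functional X (d n)) /\
    forall f, bounded_functional X f -> forall eps, 0 < eps ->
      exists n, forall x, Rabs (f x - d n x) <= eps * bnorm x.

Definition cantor := nat -> bool.

Definition cantor_continuous (f : cantor -> R) : Prop :=
  forall s eps, 0 < eps -> exists n, forall s',
    (forall k, (k < n)%nat -> s' k = s k) -> Rabs (f s' - f s) < eps.

(** Finite sequences t in D are lists of booleans; Delta_t = sequences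
    having t as initial segment. *)
Fixpoint has_prefix (t : list bool) (s : cantor) : bool :=
  match t with
  | nil => true
  | b :: t' => Bool.eqb (s 0%nat) b && has_prefix t' (fun n => s (S n))
  end.

Definition chi (t : list bool) (s : cantor) : R :=
  if has_prefix t s then 1 else 0.

Definition haar0 (s : cantor) : R := 1.
Definition haar (t : list bool) (s : cantor) : R :=
  chi (t ++ false :: nil) s - chi (t ++ true :: nil) s.

Definition is_op_to_C (X : Banach) (T : X -> cantor -> R) : Prop :=
  (forall x, cantor_continuous (T x)) /\
  (forall x y s, T (badd x y) s = T x s + T y s) /\
  (forall a x s, T (bscal a x) s = a * T x s) /\
  (exists C, forall x s, Rabs (T x s) <= C * bnorm x).

Definition opnorm_le (X : Banach) (T : X -> cantor -> R) (c : R) : Prop :=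
  forall x s, Rabs (T x s) <= c * bnorm x.

Definition in_image_ball (X : Banach) (T : X -> cantor -> R) (g : cantor -> R) : Prop :=
  exists x : X, bnorm x <= 1 /\ forall s, T x s = g s.

(* Main.v *)
(* Call a set of functionals in the dual ball small if some separable subspace of
   the dual comes close (in the sense of Riesz's lemma) to all of its members.
   Small sets form a sigma-ideal, and the ball itself is not small when the dual is
   not separable. Since the ball is weak-star second countable, its points having a
   small weak-star neighbourhood form a small set; around every other ("thick")
   point there are thick points far from any prescribed separable subspace.

   These points feed a dyadic tree of pairs (f_t, x_t). A child copies the values
   of its parent exactly on the vectors x_u chosen earlier, which a small
   finite-rank correction achieves, while x_t kills all earlier functionals and
   f_t x_t = 1; hence f_t x_u = 1 when u is an initial segment of t, and 0
   otherwise. Forcing also equality of f_t with its parent on more and more members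
   of a dense sequence makes f_(s|n) converge weak-star along every branch s, with a
   limit depending continuously on s; the limits are the operator T. Haar functions
   are differences of cylinder functions. Conversely, evaluations at distinct points
   of the Cantor set are uniformly separated functionals, so the dual cannot be
   separable. *)
Require Import Defs.
From Stdlib Require Import Reals List Lra Lia Classical IndefiniteDescription Cantor.
Open Scope R_scope.

Lemma lin_add {X : Banach} {f : X -> R} : is_linear_fun X f ->
  forall x y, f (badd x y) = f x + f y.
Proof. intros [H _]; exact H. Qed.

Lemma lin_scal {X : Banach} {f : X -> R} : is_linear_fun X f ->
  forall a x, f (bscal a x) = a * f x.
Proof. intros [_ H]; exact H. Qed.

Lemma lin_zero {X : Banach} {f : X -> R} : is_linear_fun X f -> f bzero = 0.
Proof.
intros H. pose proof (lin_add H bzero bzero) as E.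
rewrite badd_0 in E. lra.
Qed.

Lemma lin_sub {X : Banach} {f : X -> R} : is_linear_fun X f ->
  forall x y, f (badd x (bopp y)) = f x - f y.
Proof.
intros H x y. pose proof (lin_add H y (bopp y)) as E.
rewrite badd_opp, (lin_zero H) in E. rewrite (lin_add H). lra.
Qed.

Lemma linear_combination {X : Banach} (f g : X -> R) (a b : R) :
  is_linear_fun X f -> is_linear_fun X g ->
  is_linear_fun X (fun x => a * f x + b * g x).
Proof.
intros Hf Hg; split.
- intros x y. rewrite (lin_add Hf), (lin_add Hg). ring.
- intros c x. rewrite (lin_scal Hf), (lin_scal Hg). ring.
Qed.

Lemma bounded_combination {X : Banach} (f g : X -> R) (a b : R) :
  bounded_functional X f -> bounded_functional X g ->
  bounded_functional X (fun x => a * f x + b * g x).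
Proof.
intros [Hf [C HC]] [Hg [D HD]]; split; [now apply linear_combination|].
exists (Rabs a * C + Rabs b * D). intros x.
eapply Rle_trans; [apply Rabs_triang|]. rewrite !Rabs_mult.
pose proof (Rmult_le_compat_l _ _ _ (Rabs_pos a) (HC x)).
pose proof (Rmult_le_compat_l _ _ _ (Rabs_pos b) (HD x)). lra.
Qed.

Lemma bounded_functional_pos {X : Banach} (f : X -> R) : bounded_functional X f ->
  exists C, 0 < C /\ forall x, Rabs (f x) <= C * bnorm x.
Proof.
intros [_ [C HC]]. exists (Rabs C + 1). split.
- pose proof (Rabs_pos C). lra.
- intros x. pose proof (HC x). pose proof (Rle_abs C). pose proof (bnorm_ge0 X x). nra.
Qed.

Lemma bounded_zero {X : Banach} : bounded_functional X (fun _ => 0).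
Proof.
split; [split; intros; ring|]. exists 0. intros x. rewrite Rabs_R0. lra.
Qed.

(** * Finite-codimensional Hahn-Banach extension *)

(* [f - r b] is the extension of the restriction of [f] to [ker b]: any [r]
   between [sup (f y - c |y|)] and [inf (f y + c |y|)] over [b y = 1] works. *)
Lemma hahn_banach_step (X : Banach) (Y : X -> Prop) (f b : X -> R) (c : R) :
  is_linear_fun X f -> is_linear_fun X b ->
  (forall x y, Y x -> Y y -> Y (badd x y)) -> (forall a x, Y x -> Y (bscal a x)) ->
  0 <= c -> (forall x, Y x -> b x = 0 -> Rabs (f x) <= c * bnorm x) ->
  exists r, forall x, Y x -> Rabs (f x - r * b x) <= c * bnorm x.
Proof.
intros Hf Hb Yadd Yscal Hc H.
destruct (classic (exists y, Y y /\ b y <> 0)) as [[y0 [Y0 b0]]|N].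
2:{ exists 0. intros x Yx. replace (f x - 0 * b x) with (f x) by ring.
    apply H; auto. apply NNPP; intros n. apply N; exists x; auto. }
set (E := fun r => exists y, Y y /\ b y = 1 /\ r = f y - c * bnorm y).
assert (key : forall y z, Y y -> Y z -> b y = 1 -> b z = 1 ->
  f y - c * bnorm y <= f z + c * bnorm z).
{ intros y z Yy Yz by1 bz1.
  assert (K := H (badd y (bscal (-1) z)) (Yadd _ _ Yy (Yscal _ _ Yz))).
  rewrite (lin_add Hb), (lin_scal Hb), (lin_add Hf), (lin_scal Hf) in K.
  specialize (K ltac:(lra)).
  pose proof (bnorm_triangle X y (bscal (-1) z)) as T. rewrite bnorm_scal in T.
  replace (Rabs (-1)) with 1 in T by (rewrite Rabs_left; lra). pose proof (Rle_abs (f y + -1 * f z)).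
  pose proof (Rmult_le_compat_l _ _ _ Hc T). lra. }
set (y1 := bscal (/ b y0) y0).
assert (Y1 : Y y1) by (apply Yscal; auto).
assert (b1 : b y1 = 1) by (unfold y1; rewrite (lin_scal Hb); field; auto).
destruct (completeness E) as [r [Hub Hlub]].
- exists (f y1 + c * bnorm y1). intros q [y [Yy [by1 ->]]]. auto.
- exists (f y1 - c * bnorm y1). exists y1; auto.
- exists r. intros x Yx.
  destruct (Req_dec (b x) 0) as [bx|bx].
  { rewrite bx, Rmult_0_r, Rminus_0_r. auto. }
  set (y := bscal (/ b x) x).
  assert (Yy : Y y) by (apply Yscal; auto).
  assert (by1 : b y = 1) by (unfold y; rewrite (lin_scal Hb); field; auto).
  assert (L : f y - c * bnorm y <= r) by (apply Hub; exists y; auto).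
  assert (U : r <= f y + c * bnorm y).
  { apply Hlub. intros q [z [Yz [bz ->]]]. auto. }
  assert (A : Rabs (f y - r) <= c * bnorm y) by (apply Rabs_le; lra).
  replace (f x - r * b x) with (b x * (f y - r)).
  2:{ unfold y; rewrite (lin_scal Hf); field; auto. }
  replace (bnorm x) with (Rabs (b x) * bnorm y).
  2:{ unfold y; rewrite bnorm_scal, <- Rmult_assoc, <- Rabs_mult, Rinv_r, Rabs_R1; auto; ring. }
  rewrite Rabs_mult. pose proof (Rmult_le_compat_l _ _ _ (Rabs_pos (b x)) A). lra.
Qed.

Fixpoint comb {X : Banach} (e : nat -> X -> R) (l : list (nat * R)) (x : X) : R :=
  match l with
  | nil => 0
  | p :: l => snd p * e (fst p) x + comb e l x
  end.

Lemma comb_linear {X : Banach} (e : nat -> X -> R) :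
  (forall n, is_linear_fun X (e n)) -> forall l, is_linear_fun X (comb e l).
Proof.
intros He l. induction l as [|[i r] l IH]; simpl.
- apply bounded_zero.
- split; intros; simpl.
  + rewrite (lin_add (He i)), (lin_add IH). ring.
  + rewrite (lin_scal (He i)), (lin_scal IH). ring.
Qed.

Lemma comb_bounded {X : Banach} (e : nat -> X -> R) :
  (forall n, bounded_functional X (e n)) -> forall l, bounded_functional X (comb e l).
Proof.
intros He l. split; [apply comb_linear; intros n; apply He|].
induction l as [|[i r] l [C IH]]; simpl.
- exists 0. intros x. rewrite Rabs_R0. lra.
- destruct (He i) as [_ [D HD]]. exists (Rabs r * D + C). intros x.
  eapply Rle_trans; [apply Rabs_triang|]. rewrite Rabs_mult.
  pose proof (Rmult_le_compat_l _ _ _ (Rabs_pos r) (HD x)). specialize (IH x). lra.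
Qed.

Lemma comb_app {X : Banach} (e : nat -> X -> R) l1 l2 x :
  comb e (l1 ++ l2) x = comb e l1 x + comb e l2 x.
Proof. induction l1 as [|p l IH]; simpl; [|rewrite IH]; ring. Qed.

Lemma comb_scale {X : Banach} (e : nat -> X -> R) a l x :
  comb e (map (fun p => (fst p, a * snd p)) l) x = a * comb e l x.
Proof. induction l as [|p l IH]; simpl; [|rewrite IH]; ring. Qed.

Lemma hahn_banach_finite (X : Banach) (e : nat -> X -> R) (c : R) :
  (forall n, is_linear_fun X (e n)) -> 0 <= c ->
  forall (L : list nat) (f : X -> R), is_linear_fun X f ->
  (forall x, (forall i, In i L -> e i x = 0) -> Rabs (f x) <= c * bnorm x) ->
  exists l, forall x, Rabs (f x - comb e l x) <= c * bnorm x.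
Proof.
intros He Hc L. induction L as [|i L IH]; intros f Hf H.
- exists nil. intros x. simpl. rewrite Rminus_0_r. apply H. intros i [].
- destruct (hahn_banach_step X (fun x => forall j, In j L -> e j x = 0) f (e i) c)
    as [r Hr]; auto.
  + intros x y Hx Hy j Hj. rewrite (lin_add (He j)), Hx, Hy; auto; ring.
  + intros a x Hx j Hj. rewrite (lin_scal (He j)), Hx; auto; ring.
  + intros x Hx bx. apply H. intros j [<-|Hj]; auto.
  + destruct (IH (fun x => 1 * f x + (- r) * e i x)) as [l Hl].
    * apply linear_combination; auto.
    * intros x Hx. replace (1 * f x + - r * e i x) with (f x - r * e i x) by ring. auto.
    * exists ((i, r) :: l). intros x. specialize (Hl x). simpl.
      replace (f x - (r * e i x + comb e l x))
        with (1 * f x + - r * e i x - comb e l x) by ring. exact Hl.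
Qed.

(** * Countable approximation *)

Lemma inv_nat_small eps : 0 < eps -> exists n, / INR (S n) < eps.
Proof.
intros H. destruct (archimed_cor1 eps H) as [[|n] [A B]]; [lia|]. exists n; auto.
Qed.

Definition ratio (a b c : nat) : R := (INR a - INR b) / INR (S c).

Lemma ratio_dense r eps : 0 < eps -> exists a b c, Rabs (ratio a b c - r) < eps.
Proof.
intros H. destruct (inv_nat_small eps H) as [c Hc].
set (q := r * INR (S c)). destruct (archimed q) as [A B].
exists (Z.to_nat (up q)), (Z.to_nat (- up q)), c.
assert (P : 0 < INR (S c)) by (apply lt_0_INR; lia).
assert (E : INR (Z.to_nat (up q)) - INR (Z.to_nat (- up q)) = IZR (up q)).
{ rewrite !INR_IZR_INZ, <- minus_IZR. f_equal. lia. }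
unfold ratio. rewrite E.
replace (IZR (up q) / INR (S c) - r) with ((IZR (up q) - q) * / INR (S c))
  by (unfold q; field; lra).
assert (I : 0 < / INR (S c)) by (apply Rinv_0_lt_compat; auto).
rewrite Rabs_pos_eq by nra. nra.
Qed.

Definition decode_term (z : nat) : nat * R :=
  let (i, z1) := Cantor.of_nat z in
  let (a, z2) := Cantor.of_nat z1 in
  let (b, c) := Cantor.of_nat z2 in (i, ratio a b c).

Fixpoint decode_list (k z : nat) : list (nat * R) :=
  match k with
  | O => nil
  | S k => let (a, b) := Cantor.of_nat z in decode_term a :: decode_list k b
  end.

Definition decode (n : nat) : list (nat * R) :=
  let (k, z) := Cantor.of_nat n in decode_list k z.

Definition close (eps : R) : list (nat * R) -> list (nat * R) -> Prop :=
  Forall2 (fun p q => fst p = fst q /\ Rabs (snd p - snd q) < eps).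

Lemma decode_dense eps l : 0 < eps -> exists n, close eps (decode n) l.
Proof.
intros H.
assert (K : exists z, close eps (decode_list (length l) z) l).
{ induction l as [|[i r] l [z IH]].
  - exists O. constructor.
  - destruct (ratio_dense r eps H) as [a [b [c Hr]]].
    exists (Cantor.to_nat
      (Cantor.to_nat (i, Cantor.to_nat (a, Cantor.to_nat (b, c))), z)).
    cbn [decode_list length]. rewrite Cantor.cancel_of_to. constructor; auto.
    unfold decode_term. rewrite !Cantor.cancel_of_to. auto. }
destruct K as [z K]. exists (Cantor.to_nat (length l, z)).
unfold decode. rewrite Cantor.cancel_of_to. exact K.
Qed.

Lemma comb_close {X : Banach} (e : nat -> X -> R) :
  (forall n, bounded_functional X (e n)) ->
  forall l eta, 0 < eta -> exists del, 0 < del /\ forall q, close del q l ->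
  forall x, Rabs (comb e q x - comb e l x) <= eta * bnorm x.
Proof.
intros He l. induction l as [|[i r] l IH]; intros eta Heta.
- exists 1. split; [lra|]. intros q Hq x. inversion Hq; subst. simpl.
  rewrite Rminus_0_r, Rabs_R0. pose proof (bnorm_ge0 X x). nra.
- destruct (IH (eta / 2)) as [del [Hdel Hq]]; [lra|].
  destruct (bounded_functional_pos _ (He i)) as [C [HC0 HC]].
  assert (P : 0 < eta / 2 / C) by (apply Rdiv_lt_0_compat; lra).
  exists (Rmin del (eta / 2 / C)). split; [apply Rmin_glb_lt; auto|].
  intros q Hcl x. inversion Hcl as [|[j r'] ? q' ? [Hj Hr] Hcl']; subst. simpl in *. subst j.
  assert (A : Rabs (comb e q' x - comb e l x) <= eta / 2 * bnorm x).
  { apply Hq. eapply Forall2_impl; [|exact Hcl']. intros p p' [Q1 Q2]. split; auto.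
    eapply Rlt_le_trans; [exact Q2|apply Rmin_l]. }
  assert (B : Rabs ((r' - r) * e i x) <= eta / 2 * bnorm x).
  { rewrite Rabs_mult. specialize (HC x).
    assert (D : Rabs (r' - r) <= eta / 2 / C)
      by (left; eapply Rlt_le_trans; [exact Hr|apply Rmin_r]).
    replace (eta / 2 * bnorm x) with (eta / 2 / C * (C * bnorm x)) by (field; lra).
    apply Rmult_le_compat; auto using Rabs_pos. }
  replace (r' * e i x + comb e q' x - (r * e i x + comb e l x))
    with ((r' - r) * e i x + (comb e q' x - comb e l x)) by ring.
  eapply Rle_trans; [apply Rabs_triang|]. lra.
Qed.

(** * Small sets of functionals *)

Definition in_dual_ball {X : Banach} (f : X -> R) : Prop :=
  is_linear_fun X f /\ forall x, Rabs (f x) <= bnorm x.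

Lemma in_dual_ball_bounded {X : Banach} (f : X -> R) :
  in_dual_ball f -> bounded_functional X f.
Proof. intros [H K]; split; auto. exists 1. intros x. rewrite Rmult_1_l; auto. Qed.

(* By Hahn-Banach this says that the distance from [f] to the span of the [e n]
   is about [1 / rho] at least. *)
Definition far {X : Banach} (rho : R) (f : X -> R) (e : nat -> X -> R) : Prop :=
  forall L : list nat, exists x, bnorm x <= rho /\ f x = 1 /\
    forall i, In i L -> e i x = 0.

Definition small {X : Banach} (rho : R) (P : (X -> R) -> Prop) : Prop :=
  exists e : nat -> X -> R, (forall n, bounded_functional X (e n)) /\
    forall f, in_dual_ball f -> P f -> ~ far rho f e.

Lemma small_union {X : Banach} rho (P : nat -> (X -> R) -> Prop) :
  (forall n, small rho (P n)) -> small rho (fun f => exists n, P n f).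
Proof.
intros H. destruct (functional_choice _ H) as [e He].
exists (fun z => e (fst (Cantor.of_nat z)) (snd (Cantor.of_nat z))). split.
- intros z. apply He.
- intros f Bf [n Pn] F. apply (proj2 (He n) f Bf Pn).
  intros L. destruct (F (map (fun i => Cantor.to_nat (n, i)) L)) as [x [A [B C]]].
  exists x. split; [|split]; auto. intros i Hi.
  specialize (C _ (in_map _ _ _ Hi)). cbv beta in C. rewrite Cantor.cancel_of_to in C. exact C.
Qed.

Lemma small_subset {X : Banach} rho (P Q : (X -> R) -> Prop) :
  (forall f, in_dual_ball f -> P f -> Q f) -> small rho Q -> small rho P.
Proof. intros H [e [A B]]. exists e. split; auto. Qed.

Lemma almost_least (D : R -> Prop) (a rho : R) : 0 < a -> 1 < rho ->
  (exists r, D r) -> (forall r, D r -> a <= r) ->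
  exists t, D t /\ forall r, D r -> t < rho * r.
Proof.
intros Ha Hrho [r0 D0] HD.
destruct (completeness (fun q => D (- q))) as [m [Hub Hlub]].
- exists (- a). intros q Dq. apply HD in Dq. lra.
- exists (- r0). rewrite Ropp_involutive; auto.
- assert (am : a <= - m) by (enough (m <= - a) by lra; apply Hlub; intros q Dq; apply HD in Dq; lra).
  apply NNPP. intros N.
  assert (m <= rho * m); [|nra].
  apply Hlub. intros q Dq. apply Rnot_lt_le. intros Hq. apply N. exists (- q). split; auto.
  intros r Dr. assert (- r <= m) by (apply Hub; rewrite Ropp_involutive; auto). nra.
Qed.

(* Riesz's lemma: normalise [f0 - b], where [b] in the span of [e] almost
   attains the distance to [f0]. *)
Lemma dual_ball_not_small (X : Banach) (rho : R) : 1 < rho -> ~ dual_separable X ->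
  ~ small rho (fun _ : X -> R => True).
Proof.
intros Hrho NS [e [He Hsm]]. apply NS.
exists (fun n => comb e (decode n)). split; [intros n; apply comb_bounded; auto|].
intros f0 Hf0 eps Heps. apply NNPP. intros N.
assert (Hl : forall n, is_linear_fun X (e n)) by (intros n; apply He).
set (D := fun r => 0 <= r /\ exists l, forall x, Rabs (f0 x - comb e l x) <= r * bnorm x).
destruct (almost_least D (eps / 2) rho) as [t [[Ht0 [l Hl0]] Hmin]]; auto; [lra| | |].
- destruct (bounded_functional_pos _ Hf0) as [C [HC0 HC]].
  exists C. split; [lra|]. exists nil. intros x. simpl. rewrite Rminus_0_r. auto.
- intros r [Hr [l Hr']]. apply Rnot_lt_le. intros Hlt. apply N.
  destruct (comb_close e He l (eps / 2)) as [del [Hdel Hq]]; [lra|].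
  destruct (decode_dense del l Hdel) as [n Hn]. exists n. intros x.
  replace (f0 x - comb e (decode n) x)
    with ((f0 x - comb e l x) - (comb e (decode n) x - comb e l x)) by ring.
  eapply Rle_trans; [apply Rabs_triang|]. rewrite Rabs_Ropp.
  specialize (Hq _ Hn x). specialize (Hr' x). pose proof (bnorm_ge0 X x). nra.
- assert (Ht : 0 < t) by (assert (D t) as Dt by (split; eauto); specialize (Hmin t Dt); nra).
  set (f := fun x => / t * f0 x + (- / t) * comb e l x).
  assert (Ef : forall x, f0 x - comb e l x = t * f x) by (intros x; unfold f; field; lra).
  assert (Lf : is_linear_fun X f).
  { apply linear_combination; [apply Hf0|apply comb_linear; auto]. }
  assert (Ht' : 0 < / t) by (apply Rinv_0_lt_compat; auto).
  assert (Bf : in_dual_ball f).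
  { split; auto. intros x. apply Rmult_le_reg_l with t; auto.
    rewrite <- (Rabs_pos_eq t) at 1 by lra. rewrite <- Rabs_mult, <- Ef. auto. }
  apply (Hsm f Bf I). intros L. apply NNPP. intros NX.
  assert (Hr : 0 < / rho) by (apply Rinv_0_lt_compat; lra).
  destruct (hahn_banach_finite X e (/ rho) Hl (Rlt_le _ _ Hr) L f Lf) as [l2 Hl2].
  + intros x Hx. apply Rnot_lt_le. intros Hlt. apply NX.
    assert (fx : f x <> 0).
    { intros E. rewrite E, Rabs_R0 in Hlt. pose proof (bnorm_ge0 X x). nra. }
    exists (bscal (/ f x) x). split; [|split].
    * rewrite bnorm_scal, Rabs_inv. pose proof (Rabs_pos_lt _ fx) as Hp.
      apply Rmult_le_reg_l with (Rabs (f x)); auto.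
      rewrite <- Rmult_assoc, Rinv_r, Rmult_1_l by lra.
      apply Rmult_le_reg_l with (/ rho); auto.
      replace (/ rho * (Rabs (f x) * rho)) with (Rabs (f x)) by (field; lra). lra.
    * rewrite (lin_scal Lf). field; auto.
    * intros i Hi. rewrite (lin_scal (Hl i)), Hx; auto; ring.
  + assert (D (t * / rho)) as Dt.
    { split; [nra|]. exists (l ++ map (fun p => (fst p, t * snd p)) l2). intros x.
      rewrite comb_app, comb_scale.
      replace (f0 x - (comb e l x + t * comb e l2 x)) with (t * (f x - comb e l2 x))
        by (rewrite Rmult_minus_distr_l, <- Ef; ring).
      rewrite Rabs_mult, (Rabs_pos_eq t) by lra. specialize (Hl2 x). nra. }
    specialize (Hmin _ Dt). replace (rho * (t * / rho)) with t in Hmin by (field; lra). lra.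
Qed.

Definition near {X : Banach} (V : list X) (eta : R) (f g : X -> R) : Prop :=
  forall v, In v V -> Rabs (g v - f v) < eta.

Definition thin {X : Banach} (rho : R) (f : X -> R) : Prop :=
  exists V eta, 0 < eta /\ small rho (near V eta f).

Lemma thin_small (X : Banach) (rho : R) : separable X -> small rho (@thin X rho).
Proof.
intros [d Hd].
(* [W] is a countable base of the weak-star topology of the dual ball. *)
set (W := fun (z : nat) (g : X -> R) =>
  forall j q, In (j, q) (decode (snd (Cantor.of_nat z))) ->
    Rabs (g (d j) - q) < / INR (S (fst (Cantor.of_nat z)))).
apply small_subset with (fun f => exists z, W z f /\ small rho (W z)).
2:{ apply small_union. intros z. destruct (classic (small rho (W z))) as [S|NS].
    - apply small_subset with (W z); tauto.
    - exists (fun _ _ => 0). split; [intros; apply bounded_zero|]. intros f _ [_ S]. tauto. }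
intros f Bf [V [eta [Heta HV]]].
destruct (inv_nat_small (eta / 4)) as [N HN]; [lra|].
assert (PN : 0 < / INR (S N)) by (apply Rinv_0_lt_compat, lt_0_INR; lia).
assert (E : exists l : list nat, forall v, In v V ->
  exists j, In j l /\ bnorm (badd v (bopp (d j))) < eta / 4).
{ clear HV. induction V as [|v V [l IH]].
  - exists nil. intros v [].
  - destruct (Hd v (eta / 4)) as [j Hj]; [lra|]. exists (j :: l).
    intros w [<-|Hw]; [exists j; simpl; auto|].
    destruct (IH w Hw) as [i [Hi Hi']]. exists i. simpl; auto. }
destruct E as [l Hl].
destruct (decode_dense (/ INR (S N)) (map (fun j => (j, f (d j))) l) PN) as [n Hn].
assert (C1 : forall j q, In (j, q) (decode n) -> Rabs (f (d j) - q) < / INR (S N)).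
{ intros j q. revert Hn. generalize (decode n). clear.
  induction l as [|i l IH]; intros m Hm; inversion Hm as [|[i' q'] ? m' ? [Q1 Q2] Hm']; subst; simpl.
  - tauto.
  - intros [E|Hj]; [|eauto]. injection E as -> ->. simpl in *. subst i.
    rewrite Rabs_minus_sym. auto. }
assert (C2 : forall j, In j l -> exists q, In (j, q) (decode n)).
{ intros j. revert Hn. generalize (decode n). clear.
  induction l as [|i l IH]; intros m Hm; inversion Hm as [|[i' q'] ? m' ? [Q1 Q2] Hm']; subst; simpl.
  - tauto.
  - intros [E|Hj]; [simpl in *; subst; eauto|].
    destruct (IH _ Hm' Hj) as [q Hq]. eauto. }
exists (Cantor.to_nat (N, n)). unfold W. rewrite Cantor.cancel_of_to. split; [exact C1|].
apply small_subset with (near V eta f); auto.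
intros g Bg Wg v Hv. destruct (Hl v Hv) as [j [Hj Hvj]].
destruct (C2 j Hj) as [q Hq]. specialize (C1 _ _ Hq). specialize (Wg _ _ Hq). cbn [fst] in Wg.
pose proof (Rle_lt_trans _ _ _ (proj2 Bg (badd v (bopp (d j)))) Hvj) as Gv.
pose proof (Rle_lt_trans _ _ _ (proj2 Bf (badd v (bopp (d j)))) Hvj) as Fv.
rewrite (lin_sub (proj1 Bg)) in Gv. rewrite (lin_sub (proj1 Bf)) in Fv.
apply Rabs_def2 in C1, Wg, Gv, Fv. apply Rabs_def1; lra.
Qed.

Definition thick {X : Banach} (rho : R) (g : X -> R) : Prop :=
  in_dual_ball g /\ ~ thin rho g.

Lemma thick_exists (X : Banach) (rho : R) : 1 < rho -> separable X -> ~ dual_separable X ->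
  exists g : X -> R, thick rho g.
Proof.
intros Hr S NS. apply NNPP. intros N. apply (dual_ball_not_small X rho Hr NS).
apply small_subset with (thin rho); [|now apply thin_small].
intros f Bf _. apply NNPP. intros T. apply N. exists f. split; auto.
Qed.

Lemma thick_near (X : Banach) (rho : R) (g : X -> R) (V : list X) (eta : R)
  (L : list (X -> R)) : separable X -> thick rho g -> 0 < eta ->
  (forall e, In e L -> bounded_functional X e) ->
  exists a x, thick rho a /\ near V eta g a /\ bnorm x <= rho /\ a x = 1 /\
    forall e, In e L -> e x = 0.
Proof.
intros S [Bg Tg] Heta HL. destruct (thin_small X rho S) as [e [He Hth]].
set (e' := fun n => if Nat.even n then e (Nat.div2 n) else nth (Nat.div2 n) L (fun _ => 0)).
apply NNPP. intros N. apply Tg. exists V, eta. split; auto.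
exists e'. split.
- intros n. unfold e'. destruct (Nat.even n); auto.
  destruct (nth_in_or_default (Nat.div2 n) L (fun _ => 0)) as [H| -> ]; auto. apply bounded_zero.
- intros a Ba Na F. apply N.
  destruct (F (map (fun i => 2 * i + 1)%nat (seq 0 (length L)))) as [x [Hx [a1 Lx]]].
  exists a, x. split; [split; [exact Ba|]|do 3 (split; [assumption|])].
  + intros Ta. apply (Hth a Ba Ta).
    intros M. destruct (F (map (fun i => 2 * i)%nat M)) as [y [Hy [a2 Ly]]].
    exists y. do 2 (split; [assumption|]). intros i Hi.
    specialize (Ly _ (in_map _ _ _ Hi)). unfold e' in Ly.
    rewrite Nat.even_even, Nat.div2_double in Ly. exact Ly.
  + intros u Hu. destruct (In_nth L u (fun _ => 0) Hu) as [i [Hi <-]].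
    assert (Hi' : In i (seq 0 (length L))) by (apply in_seq; lia).
    specialize (Lx _ (in_map _ _ _ Hi')). unfold e' in Lx.
    rewrite Nat.even_odd, Nat.add_1_r, Nat.div2_succ_double in Lx. exact Lx.
Qed.

(** * Correcting functionals on finitely many vectors *)

Lemma correction (X : Banach) (V : list X) :
  exists (C : R) (Phi : list (X -> R)), 0 <= C /\
    (forall e, In e Phi -> bounded_functional X e) /\
    forall g M, bounded_functional X g -> (forall v, In v V -> Rabs (g v) <= M) -> 0 <= M ->
    exists phi, is_linear_fun X phi /\ (forall v, In v V -> phi v = g v) /\
      (forall x, Rabs (phi x) <= C * M * bnorm x) /\
      forall x, (forall e, In e Phi -> e x = 0) -> phi x = 0.
Proof.
induction V as [|v V [C [Phi [HC [HPhi IH]]]]].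
- exists 0, nil. split; [lra|]. split; [intros e []|]. intros g M _ _ _.
  exists (fun _ => 0). split; [apply bounded_zero|]. split; [intros v []|]. split; auto.
  intros x. rewrite Rabs_R0. lra.
- destruct (classic (exists psi, bounded_functional X psi /\
    (forall w, In w V -> psi w = 0) /\ psi v <> 0)) as [[psi [Bpsi [V0 v1]]]|N].
  + destruct (bounded_functional_pos psi Bpsi) as [D [HD0 HD]].
    set (K := (1 + C * bnorm v) * / Rabs (psi v)).
    assert (Hv : 0 < Rabs (psi v)) by (apply Rabs_pos_lt; auto).
    assert (HK : 0 <= K).
    { apply Rmult_le_pos; [|left; apply Rinv_0_lt_compat; auto].
      pose proof (bnorm_ge0 X v). nra. }
    exists (C + K * D), (psi :: Phi). split; [nra|]. split.
    { intros e [<-|He]; auto. }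
    intros g M Bg HM M0.
    destruct (IH g M Bg) as [phi [Lphi [Ephi [Nphi Aphi]]]]; [intros; apply HM; simpl; auto|auto|].
    set (r := (g v - phi v) * / psi v).
    assert (Hr : Rabs r <= K * M).
    { unfold r, K. rewrite Rabs_mult, Rabs_inv.
      assert (Rabs (g v - phi v) <= (1 + C * bnorm v) * M).
      { pose proof (HM v (or_introl eq_refl)). pose proof (Nphi v).
        pose proof (Rabs_triang (g v) (- phi v)). rewrite Rabs_Ropp in *.
        unfold Rminus. lra. }
      assert (0 < / Rabs (psi v)) by (apply Rinv_0_lt_compat; auto). nra. }
    exists (fun x => 1 * phi x + r * psi x). split; [|split; [|split]].
    * apply linear_combination; auto. apply Bpsi.
    * intros w [<-|Hw]; [unfold r; field; auto|]. rewrite V0, Ephi; auto; ring.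
    * intros x. eapply Rle_trans; [apply Rabs_triang|]. rewrite Rmult_1_l, Rabs_mult.
      pose proof (Nphi x).
      pose proof (Rmult_le_compat _ _ _ _ (Rabs_pos r) (Rabs_pos (psi x)) Hr (HD x)). nra.
    * intros x Hx. rewrite Aphi, (Hx psi); simpl; auto; [ring|].
      intros e He. apply Hx; simpl; auto.
  + exists C, Phi. split; auto. split; auto. intros g M Bg HM M0.
    destruct (IH g M Bg) as [phi [Lphi [Ephi [Nphi Aphi]]]]; [intros; apply HM; simpl; auto|auto|].
    exists phi. split; [|split]; auto. intros w [<-|Hw]; auto.
    apply NNPP. intros E. apply N. exists (fun x => 1 * phi x + (-1) * g x).
    split; [|split].
    * apply bounded_combination; auto. split; auto. exists (C * M); auto.
    * intros w Hw. rewrite Ephi; auto; ring.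
    * lra.
Qed.

(** * The tree of functionals *)

Lemma strong_dependent_choice (A : Type) (a0 : A) (P : nat -> (nat -> A) -> A -> Prop) :
  (forall n h h' a, (forall k, (k < n)%nat -> h k = h' k) -> P n h a -> P n h' a) ->
  (forall n h, (forall m, (m < n)%nat -> P m h (h m)) -> exists a, P n h a) ->
  exists h, forall n, P n h (h n).
Proof.
intros Pext Pstep.
destruct (functional_choice (fun (q : nat * (nat -> A)) a =>
  (forall m, (m < fst q)%nat -> P m (snd q) (snd q m)) -> P (fst q) (snd q) a)) as [next Hnext].
{ intros [n h]. simpl.
  destruct (classic (forall m, (m < n)%nat -> P m h (h m))) as [H|H].
  - destruct (Pstep n h H) as [a Ha]. exists a; auto.
  - exists a0. tauto. }
set (H := fix H n := match n with
  | O => fun _ => a0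
  | S n => fun k => if Nat.eqb k n then next (n, H n) else H n k end).
set (h := fun k => H (S k) k).
assert (HE : forall n k, (k < n)%nat -> H n k = h k).
{ induction n as [|n IH]; intros k Hk; [lia|]. simpl.
  destruct (Nat.eqb_spec k n) as [->|Hn].
  - unfold h. simpl. rewrite Nat.eqb_refl. reflexivity.
  - apply IH; lia. }
exists h. intros n. induction n as [n IH] using (well_founded_induction Wf_nat.lt_wf).
apply Pext with (H n); auto. unfold h. simpl. rewrite Nat.eqb_refl.
apply (Hnext (n, H n)). simpl. intros m Hm. rewrite HE by auto.
apply Pext with h; auto. intros k Hk. symmetry. apply HE. lia.
Qed.

Record node (X : Banach) := Node { nfun : X -> R; napprox : X -> R; nvec : X }.
Arguments Node {_}. Arguments nfun {_}. Arguments napprox {_}. Arguments nvec {_}.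

(* Nodes are heap-indexed: [1] is the root of the dyadic tree, the parent of [n]
   is [n / 2]; index [0] is an auxiliary start whose vector is not constrained. *)
Definition node_ok {X : Banach} (d : nat -> X) (rho eps : R) (n : nat) (h : nat -> node X)
  (s : node X) : Prop :=
  thick rho (napprox s) /\ is_linear_fun X (nfun s) /\
  (exists k, 0 <= k < eps /\ forall y, Rabs (nfun s y - napprox s y) <= k * bnorm y) /\
  ((1 <= n)%nat -> bnorm (nvec s) <= rho /\ nfun s (nvec s) = 1 /\
    forall k, (k < n)%nat -> nfun (h k) (nvec s) = 0 /\
      nfun s (nvec (h k)) = nfun (h (Nat.div2 n)) (nvec (h k)) /\
      nfun s (d k) = nfun (h (Nat.div2 n)) (d k)).

Lemma node_bound {X : Banach} (d : nat -> X) rho eps n h s : node_ok d rho eps n h s ->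
  forall y, Rabs (nfun s y) <= (1 + eps) * bnorm y.
Proof.
intros [[[_ B] _] [_ [[k [Hk H]] _]]] y. specialize (B y). specialize (H y).
pose proof (Rabs_triang (nfun s y - napprox s y) (napprox s y)) as T.
replace (nfun s y - napprox s y + napprox s y) with (nfun s y) in T by ring.
pose proof (bnorm_ge0 X y). nra.
Qed.

Lemma node_bounded {X : Banach} (d : nat -> X) rho eps n h s : node_ok d rho eps n h s ->
  bounded_functional X (nfun s).
Proof.
intros H. split; [apply H|]. exists (1 + eps). eapply node_bound; eauto.
Qed.

(* The new functional is [a + (f - g) + phi], where [f], [g] belong to the parent,
   [a] is weak-star close to [g] and the small correction [phi] restores the exact
   values of [f] on the vectors chosen so far; the new vector kills all the old
   functionals and [phi]. *)
Lemma node_step (X : Banach) (d : nat -> X) (rho eps : R) (g0 : X -> R) :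
  separable X -> 0 < eps -> thick rho g0 ->
  forall n h, (forall m, (m < n)%nat -> node_ok d rho eps m h (h m)) ->
  exists s, node_ok d rho eps n h s.
Proof.
intros S Heps T0 n h Hh. destruct n as [|n].
{ exists (Node g0 g0 bzero). split; [|split; [|split]]; simpl; auto.
  - apply T0.
  - exists 0. split; [lra|]. intros y. rewrite Rminus_diag, Rabs_R0. lra.
  - lia. }
set (N := Datatypes.S n) in *.
set (p := h (Nat.div2 N)).
assert (HpN : (Nat.div2 N < N)%nat) by (apply Nat.lt_div2; unfold N; lia).
assert (Hp : node_ok d rho eps (Nat.div2 N) h p) by (apply Hh; auto).
pose proof (node_bounded _ _ _ _ _ _ Hp) as Bp.
destruct Hp as [Tp [_ [[k [Hk Hkp]] _]]].
pose proof (in_dual_ball_bounded _ (proj1 Tp)) as Bg.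
set (V := map (fun j => nvec (h j)) (seq 0 N) ++ map d (seq 0 N)).
destruct (correction X V) as [C [Phi [HC [HPhi Hcor]]]].
set (M := (eps - k) / 2 / (C + 1)).
assert (HM : 0 < M) by (apply Rdiv_lt_0_compat; lra).
assert (HCM : C * M <= (eps - k) / 2).
{ replace ((eps - k) / 2) with ((C + 1) * M) by (unfold M; field; lra). nra. }
set (q := fun y => 1 * nfun p y + (-1) * napprox p y).
destruct (thick_near X rho (napprox p) V M
  (q :: map (fun j => nfun (h j)) (seq 0 N) ++ Phi)) as [a [x [Ta [Na [Hx [a1 Lx]]]]]]; auto.
{ intros e [<-|He]; [apply bounded_combination; auto|].
  apply in_app_or in He. destruct He as [He|He]; auto.
  apply in_map_iff in He. destruct He as [j [<- Hj]]. apply in_seq in Hj.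
  eapply node_bounded, Hh. lia. }
pose proof (in_dual_ball_bounded _ (proj1 Ta)) as Ba.
destruct (Hcor (fun y => 1 * napprox p y + (-1) * a y) M) as [phi [Lphi [Ephi [Nphi Aphi]]]].
{ apply bounded_combination; auto. }
{ intros v Hv. specialize (Na v Hv). rewrite Rabs_minus_sym in Na.
  replace (1 * napprox p v + -1 * a v) with (napprox p v - a v) by ring. lra. }
{ lra. }
set (f := fun y => 1 * a y + 1 * (1 * q y + 1 * phi y)).
assert (Ef : forall v, In v V -> f v = nfun p v).
{ intros v Hv. unfold f, q. rewrite Ephi by auto. ring. }
exists (Node f a x). split; [|split; [|split]]; simpl; auto.
- apply linear_combination; [apply Ba|]. apply linear_combination; auto.
  apply linear_combination; [apply Bp|apply Bg].
- exists (k + (eps - k) / 2). split; [lra|]. intros y.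
  replace (f y - a y) with ((nfun p y - napprox p y) + phi y) by (unfold f, q; ring).
  eapply Rle_trans; [apply Rabs_triang|]. specialize (Hkp y). specialize (Nphi y).
  pose proof (Rmult_le_compat_r _ _ _ (bnorm_ge0 X y) HCM). lra.
- intros _. split; auto. split.
  { unfold f. rewrite a1, (Lx q) by (simpl; auto). rewrite Aphi; [ring|].
    intros e He. apply Lx. right. apply in_or_app. auto. }
  intros j Hj. assert (Hj' : In j (seq 0 N)) by (apply in_seq; lia). split; [|split].
  + apply (Lx (nfun (h j))). right. apply in_or_app. left.
    apply (in_map (fun j => nfun (h j))), Hj'.
  + apply Ef, in_or_app. left. apply (in_map (fun j => nvec (h j))), Hj'.
  + apply Ef, in_or_app. right. apply in_map, Hj'.
Qed.

(** * Branches of the Cantor set *)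

Fixpoint trace (s : cantor) (n : nat) : list bool :=
  match n with
  | O => nil
  | S n => s n :: trace s n
  end.

Lemma trace_length s n : length (trace s n) = n.
Proof. induction n; simpl; auto. Qed.

Lemma trace_ext s s' n : (forall k, (k < n)%nat -> s k = s' k) -> trace s n = trace s' n.
Proof.
intros H. induction n as [|n IH]; simpl; auto. rewrite IH, (H n) by auto. reflexivity.
Qed.

Lemma trace_shift s n : trace s (S n) = trace (fun k => s (S k)) n ++ s O :: nil.
Proof. induction n as [|n IH]; [reflexivity|]. simpl in *. rewrite IH. reflexivity. Qed.

Lemma has_prefix_trace t s : has_prefix t s = true <-> rev t = trace s (length t).
Proof.
revert s. induction t as [|b t IH]; intros s; cbn [has_prefix rev length]; [tauto|].
rewrite trace_shift, Bool.andb_true_iff, Bool.eqb_true_iff, IH. split.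
- intros [-> ->]. reflexivity.
- intros H. apply app_inj_tail in H. destruct H; split; auto.
Qed.

(* Digits are read from the last one, so that the parent of [b :: l] is [l]. *)
Fixpoint heap_index (l : list bool) : nat :=
  match l with
  | nil => 1
  | b :: l => 2 * heap_index l + Nat.b2n b
  end.

Lemma heap_index_pos l : (1 <= heap_index l)%nat.
Proof. induction l; simpl; lia. Qed.

Lemma heap_index_inj l l' : heap_index l = heap_index l' -> l = l'.
Proof.
revert l'. induction l as [|b l IH]; intros [|b' l']; simpl; auto;
  try pose proof (heap_index_pos l); try pose proof (heap_index_pos l').
- lia.
- lia.
- intros E. destruct b, b'; simpl in E; try lia; f_equal; apply IH; lia.
Qed.

Lemma heap_index_parent b l : Nat.div2 (heap_index (b :: l)) = heap_index l.
Proof.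
cbn [heap_index]. destruct b; cbn [Nat.b2n].
- rewrite Nat.add_1_r. apply Nat.div2_succ_double.
- rewrite Nat.add_0_r. apply Nat.div2_double.
Qed.

Lemma heap_index_lt b l : (heap_index l < heap_index (b :: l))%nat.
Proof. pose proof (heap_index_pos l). simpl. lia. Qed.

Lemma heap_index_trace_ge s n : (n < heap_index (trace s n))%nat.
Proof.
induction n as [|n IH]; [simpl; lia|].
pose proof (heap_index_lt (s n) (trace s n)). cbn [trace]. lia.
Qed.


Lemma branch_value {X : Banach} (f : nat -> X -> R) (x : nat -> X) :
  (forall n, (1 <= n)%nat -> f n (x n) = 1) ->
  (forall n k, (k < n)%nat -> f k (x n) = 0) ->
  (forall n k, (k < n)%nat -> f n (x k) = f (Nat.div2 n) (x k)) ->
  forall t s n, (length t <= n)%nat -> f (heap_index (trace s n)) (x (heap_index (rev t))) = chi t s.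
Proof.
intros H1 H0 Hp t s n Hn. unfold chi. destruct (has_prefix t s) eqn:E.
- apply has_prefix_trace in E. rewrite E. clear E.
  induction Hn as [|n Hn IH].
  + apply H1, heap_index_pos.
  + cbn [trace]. rewrite Hp, heap_index_parent; auto.
    eapply Nat.le_lt_trans; [|apply heap_index_lt].
    clear IH. induction Hn as [|n Hn IH]; auto.
    pose proof (heap_index_lt (s n) (trace s n)). cbn [trace]. lia.
- assert (N : forall n, heap_index (rev t) <> heap_index (trace s n)).
  { intros m Hm. apply heap_index_inj in Hm.
    assert (m = length t) by (rewrite <- (trace_length s m), <- Hm; apply length_rev).
    subst m. apply has_prefix_trace in Hm. congruence. }
  clear Hn. induction n as [|n IH].
  + pose proof (heap_index_pos (rev t)). specialize (N O). apply H0. simpl in *. lia.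
  + specialize (N (S n)).
    destruct (Nat.lt_trichotomy (heap_index (rev t)) (heap_index (trace s (S n)))) as [L|[L|L]].
    * rewrite Hp by auto. cbn [trace]. rewrite heap_index_parent. exact IH.
    * contradiction.
    * apply H0, L.
Qed.

Lemma Un_cv_Rabs_le (u : nat -> R) (l c : R) (N : nat) :
  Un_cv u l -> (forall n, (N <= n)%nat -> Rabs (u n) <= c) -> Rabs l <= c.
Proof.
intros H B. apply Rnot_lt_le. intros L.
destruct (H (Rabs l - c)) as [M HM]; [lra|].
specialize (HM (max M N) ltac:(lia)). specialize (B (max M N) ltac:(lia)).
unfold Rdist in HM. rewrite Rabs_minus_sym in HM.
pose proof (Rabs_triang_inv l (u (max M N))). lra.
Qed.

Lemma Un_cv_const (c : R) : Un_cv (fun _ => c) c.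
Proof. intros eps H. exists O. intros n _. unfold Rdist. rewrite Rminus_diag, Rabs_R0. exact H. Qed.

Lemma branch_limit (X : Banach) (f : nat -> X -> R) (d : nat -> X) (K : R) :
  (forall x eps, 0 < eps -> exists n, bnorm (badd x (bopp (d n))) < eps) -> 0 <= K ->
  (forall n, is_linear_fun X (f n)) -> (forall n x, Rabs (f n x) <= K * bnorm x) ->
  (forall n k, (k < n)%nat -> f n (d k) = f (Nat.div2 n) (d k)) ->
  exists T, is_op_to_C X T /\ opnorm_le X T K /\
    forall x s c N, (forall n, (N <= n)%nat -> f (heap_index (trace s n)) x = c) -> T x s = c.
Proof.
intros Hd HK Lf Bf Hp.
set (F := fun s n => f (heap_index (trace s n))).
assert (F0 : forall s j n, (j <= n)%nat -> F s n (d j) = F s j (d j)).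
{ intros s j n Hn. induction Hn as [|n Hn IH]; auto. rewrite <- IH. unfold F.
  rewrite Hp; [cbn [trace]; rewrite heap_index_parent; reflexivity|].
  pose proof (heap_index_trace_ge s (S n)). lia. }
assert (U : forall x eps, 0 < eps -> exists N, forall s s' n n',
  (N <= n)%nat -> (N <= n')%nat -> (forall k, (k < N)%nat -> s' k = s k) ->
  Rabs (F s' n' x - F s n x) < eps).
{ intros x eps Heps.
  destruct (Hd x (eps / (2 * K + 1))) as [j Hj]; [apply Rdiv_lt_0_compat; lra|].
  exists j. intros s s' n n' Hn Hn' Hs.
  assert (E : F s' n' (d j) = F s n (d j)).
  { rewrite (F0 s' j n'), (F0 s j n) by auto. unfold F. rewrite (trace_ext _ _ _ Hs). reflexivity. }
  pose proof (Bf (heap_index (trace s n)) (badd x (bopp (d j)))) as A.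
  pose proof (Bf (heap_index (trace s' n')) (badd x (bopp (d j)))) as A'.
  rewrite (lin_sub (Lf _)) in A. rewrite (lin_sub (Lf _)) in A'.
  change (Rabs (F s n x - F s n (d j)) <= K * bnorm (badd x (bopp (d j)))) in A.
  change (Rabs (F s' n' x - F s' n' (d j)) <= K * bnorm (badd x (bopp (d j)))) in A'.
  replace (F s' n' x - F s n x)
    with ((F s' n' x - F s' n' (d j)) - (F s n x - F s n (d j))) by (rewrite E; ring).
  assert (B : (2 * K + 1) * bnorm (badd x (bopp (d j))) < eps).
  { apply Rmult_lt_compat_l with (r := 2 * K + 1) in Hj; [|lra].
    replace ((2 * K + 1) * (eps / (2 * K + 1))) with eps in Hj by (field; lra). exact Hj. }
  pose proof (bnorm_ge0 X (badd x (bopp (d j)))).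
  eapply Rle_lt_trans; [apply Rabs_triang|]. rewrite Rabs_Ropp. lra. }
assert (Cau : forall x s, Cauchy_crit (fun n => F s n x)).
{ intros x s eps Heps. destruct (U x eps Heps) as [N HN]. exists N. intros n m Hn Hm.
  apply HN; auto. }
set (T := fun x s => proj1_sig (R_complete _ (Cau x s))).
assert (HT : forall x s, Un_cv (fun n => F s n x) (T x s)).
{ intros x s. exact (proj2_sig (R_complete _ (Cau x s))). }
assert (NT : opnorm_le X T K).
{ intros x s. apply (Un_cv_Rabs_le _ _ _ 0 (HT x s)). intros n _. apply Bf. }
exists T. split; [split; [|split; [|split]]|split]; auto.
- intros x s eps Heps. destruct (U x (eps / 2)) as [N HN]; [lra|]. exists N. intros s' Hs.
  apply Rle_lt_trans with (eps / 2); [|lra].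
  apply (Un_cv_Rabs_le _ _ _ N (CV_minus _ _ _ _ (HT x s') (HT x s))).
  intros n Hn. left. apply HN; auto.
- intros x y s. apply (UL_sequence (fun n => F s n (badd x y))); auto.
  apply (Un_cv_ext (fun n => F s n x + F s n y)); [|apply CV_plus; auto].
  intros n. symmetry. apply (lin_add (Lf _)).
- intros a x s. apply (UL_sequence (fun n => F s n (bscal a x))); auto.
  apply (Un_cv_ext (fun n => a * F s n x)); [|apply CV_mult; auto using Un_cv_const].
  intros n. symmetry. apply (lin_scal (Lf _)).
- exists K. exact NT.
- intros x s c N H. apply Rminus_diag_uniq, NNPP. intros E.
  assert (A : Rabs (T x s - c) <= 0).
  { apply (Un_cv_Rabs_le _ _ _ N (CV_minus _ _ _ _ (HT x s) (Un_cv_const c))).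
    intros n Hn. unfold F. rewrite H by auto. rewrite Rminus_diag, Rabs_R0. lra. }
  pose proof (Rabs_pos_lt _ E). lra.
Qed.

Lemma op_to_C_scal (X : Banach) (T : X -> cantor -> R) (c K : R) : 0 < c ->
  is_op_to_C X T -> opnorm_le X T K ->
  is_op_to_C X (fun x s => c * T x s) /\ opnorm_le X (fun x s => c * T x s) (c * K).
Proof.
intros Hc [HC [HA [HS _]]] HK.
assert (B : opnorm_le X (fun x s => c * T x s) (c * K)).
{ intros x s. rewrite Rabs_mult, Rabs_pos_eq by lra. specialize (HK x s). nra. }
split; auto. split; [|split; [|split]].
- intros x s eps Heps. destruct (HC x s (eps / c)) as [n Hn]; [apply Rdiv_lt_0_compat; lra|].
  exists n. intros s' Hs. rewrite <- Rmult_minus_distr_l, Rabs_mult, Rabs_pos_eq by lra.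
  specialize (Hn s' Hs). apply Rmult_lt_compat_l with (r := c) in Hn; auto.
  replace (c * (eps / c)) with eps in Hn by (field; lra). exact Hn.
- intros x y s. rewrite HA. ring.
- intros a x s. rewrite HS. ring.
- exists (c * K). exact B.
Qed.

Lemma operator_onto_cylinders (X : Banach) : separable X -> ~ dual_separable X ->
  forall eps, 0 < eps -> exists T : X -> cantor -> R,
    is_op_to_C X T /\ opnorm_le X T (1 + eps) /\ forall t, in_image_ball X T (chi t).
Proof.
intros S NS eps Heps.
set (del := Rmin 1 (eps / 3)).
assert (Hdel : 0 < del <= 1 /\ del <= eps / 3).
{ unfold del. split; [split|]; [apply Rmin_glb_lt; lra|apply Rmin_l|apply Rmin_r]. }
set (rho := 1 + del).
destruct (thick_exists X rho ltac:(unfold rho; lra) S NS) as [g0 T0].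
pose proof S as [d Hd].
destruct (strong_dependent_choice (node X) (Node g0 g0 bzero) (node_ok d rho del)) as [h Hh].
{ intros n h h' s E [A [B [C D]]]. split; [|split; [|split]]; auto.
  intros Hn. destruct (D Hn) as [D1 [D2 D3]]. split; [|split]; auto.
  intros k Hk. rewrite <- !E by (auto using Nat.lt_div2). auto. }
{ apply node_step with g0; auto; lra. }
assert (Hd2 : forall n k, (k < n)%nat -> (1 <= n)%nat) by (intros; lia).
destruct (branch_limit X (fun n => nfun (h n)) d (1 + del) Hd) as [T [OT [NT VT]]].
- lra.
- intros n. apply (Hh n).
- intros n. eapply node_bound, Hh.
- intros n k Hk. apply (Hh n); eauto.
- destruct (op_to_C_scal X T rho (1 + del)) as [OT' NT']; auto; [unfold rho; lra|].
  exists (fun x s => rho * T x s). split; [|split]; auto.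
  + intros x s. eapply Rle_trans; [apply NT'|].
    apply Rmult_le_compat_r; [apply bnorm_ge0|]. unfold rho. nra.
  + intros t. set (x := nvec (h (heap_index (rev t)))).
    exists (bscal (/ rho) x). split.
    * rewrite bnorm_scal. assert (Hr : 0 < rho) by (unfold rho; lra).
      assert (0 < / rho) by (apply Rinv_0_lt_compat; auto).
      rewrite Rabs_pos_eq by lra. apply Rmult_le_reg_l with rho; auto.
      rewrite <- Rmult_assoc, Rinv_r, Rmult_1_l, Rmult_1_r by lra.
      apply (Hh (heap_index (rev t))), heap_index_pos.
    * intros s. destruct OT as [_ [_ [OS _]]]. rewrite OS, <- Rmult_assoc, Rinv_r, Rmult_1_l
        by (unfold rho; lra).
      apply VT with (length t). intros n Hn.
      apply (branch_value (fun n => nfun (h n)) (fun n => nvec (h n))); auto.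
      -- intros m Hm. apply (Hh m); auto.
      -- intros m k Hk. apply (Hh m); eauto.
      -- intros m k Hk. apply (Hh m); eauto.
Qed.

Lemma haar_of_cylinders (X : Banach) (T : X -> cantor -> R) (K : R) :
  is_op_to_C X T -> opnorm_le X T K -> (forall t, in_image_ball X T (chi t)) ->
  exists Rop : X -> cantor -> R, is_op_to_C X Rop /\ opnorm_le X Rop (2 * K) /\
    in_image_ball X Rop haar0 /\ forall t, in_image_ball X Rop (haar t).
Proof.
intros OT NT IT. destruct (op_to_C_scal X T 2 K) as [OR NR]; auto; [lra|].
exists (fun x s => 2 * T x s). destruct OT as [_ [HA [HS _]]].
split; [|split; [|split]]; auto.
- destruct (IT nil) as [x [Hx Ex]]. exists (bscal (/ 2) x). split.
  + rewrite bnorm_scal, Rabs_pos_eq by lra. pose proof (bnorm_ge0 X x). lra.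
  + intros s. rewrite HS, Ex. unfold chi, haar0; simpl. field.
- intros t. destruct (IT (t ++ false :: nil)) as [x [Hx Ex]].
  destruct (IT (t ++ true :: nil)) as [y [Hy Ey]].
  exists (badd (bscal (/ 2) x) (bscal (- / 2) y)). split.
  + eapply Rle_trans; [apply bnorm_triangle|]. rewrite !bnorm_scal, Rabs_Ropp, Rabs_pos_eq by lra.
    lra.
  + intros s. rewrite HA, !HS, Ex, Ey. unfold haar. field.
Qed.

Lemma separated_dual_not_separable (X : Banach) (T : X -> cantor -> R) :
  is_op_to_C X T ->
  (forall s s' k, trace s k = trace s' k -> s k <> s' k ->
    exists x, bnorm x <= 1 /\ 1 <= Rabs (T x s - T x s')) ->
  ~ dual_separable X.
Proof.
intros [_ [HA [HS [C HC]]]] Sep [d [_ Hd]].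
destruct (functional_choice (fun (s : cantor) n =>
  forall x, Rabs (T x s - d n x) <= / 3 * bnorm x)) as [N HN].
{ intros s. apply (Hd (fun x => T x s)); [|lra].
  split; [split; auto|exists C; auto]. }
assert (Inj : forall s s', N s = N s' -> forall k, s k = s' k).
{ intros s s' E k. induction k as [k IH] using (well_founded_induction Wf_nat.lt_wf).
  apply NNPP. intros D. destruct (Sep s s' k (trace_ext _ _ _ IH) D) as [x [Hx Dx]].
  pose proof (HN s x) as A. pose proof (HN s' x) as A'. rewrite <- E in A'.
  replace (T x s - T x s') with ((T x s - d (N s) x) - (T x s' - d (N s) x)) in Dx by ring.
  pose proof (Rabs_triang (T x s - d (N s) x) (- (T x s' - d (N s) x))) as Tr.
  rewrite Rabs_Ropp in Tr. unfold Rminus at 1 in Dx. lra. }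
destruct (functional_choice (fun n b => forall s, N s = n -> s n <> b)) as [s Hs].
{ intros n. destruct (classic (exists s, N s = n)) as [[s Es]|No].
  - exists (negb (s n)). intros s' Es' H. rewrite (Inj s' s) in H by congruence.
    destruct (s n); discriminate.
  - exists true. intros s Es. exfalso. eauto. }
exact (Hs (N s) s eq_refl eq_refl).
Qed.

Lemma chi_snoc b s k s' : trace s k = trace s' k ->
  chi (rev (trace s k) ++ b :: nil) s' = if Bool.eqb (s' k) b then 1 else 0.
Proof.
intros E. change (rev (trace s k) ++ b :: nil) with (rev (b :: trace s k)). unfold chi.
replace (has_prefix (rev (b :: trace s k)) s') with (Bool.eqb (s' k) b); auto.
apply Bool.eq_iff_eq_true.
rewrite has_prefix_trace, rev_involutive, length_rev, Bool.eqb_true_iff.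
cbn [length]. rewrite trace_length, E. cbn [trace]. split; congruence.
Qed.

Theorem theorem6p1 (X : Banach) (hX : separable X) :
  (~ dual_separable X <->
     (forall eps, 0 < eps -> exists T : X -> cantor -> R,
        is_op_to_C X T /\ opnorm_le X T (1 + eps) /\
        forall t : list bool, in_image_ball X T (chi t)))
  /\
  (~ dual_separable X <->
     (forall eps, 0 < eps -> exists Rop : X -> cantor -> R,
        is_op_to_C X Rop /\ opnorm_le X Rop (2 + eps) /\
        in_image_ball X Rop haar0 /\
        forall t : list bool, in_image_ball X Rop (haar t))).
Proof.
split; split.
- apply operator_onto_cylinders, hX.
- intros H. destruct (H 1 Rlt_0_1) as [T [OT [_ IT]]].
  apply (separated_dual_not_separable X T OT). intros s s' k E D.
  destruct (IT (rev (trace s k) ++ s k :: nil)) as [x [Hx Ex]]. exists x. split; auto.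
  rewrite !Ex, !chi_snoc by auto.
  destruct (s k), (s' k); try congruence; simpl;
    rewrite Rminus_0_r, Rabs_R1; lra.
- intros NS eps Heps.
  destruct (operator_onto_cylinders X hX NS (eps / 2)) as [T [OT [NT IT]]]; [lra|].
  replace (2 + eps) with (2 * (1 + eps / 2)) by field.
  now apply haar_of_cylinders with T.
- intros H. destruct (H 1 Rlt_0_1) as [T [OT [_ [_ IT]]]].
  apply (separated_dual_not_separable X T OT). intros s s' k E D.
  destruct (IT (rev (trace s k))) as [x [Hx Ex]]. exists x. split; auto.
  rewrite !Ex. unfold haar. rewrite !chi_snoc by auto.
  destruct (s k), (s' k); try congruence; simpl; unfold Rabs; destruct Rcase_abs; lra.
Qed.
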